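(* Every $\omega_1$-unital C*-algebra is $\ll$-unital.
   Context: Let $A$ be a C*-algebra. $A^1_+$ denotes the set of positive elements of norm at most $1$. For $a,b\in A$, $a\ll b$ means $a=ab$. A directed set $(\Lambda,\prec)$ is a set with a transitive (not necessarily reflexive) relation $\prec$ such that for all $\lambda,\mu\in\Lambda$ there is $\nu\in\Lambda$ with $\lambda\prec\nu$ and $\mu\prec\nu$. An approximate unit of $A$ is a net $(u_\lambda)_{\lambda\in\Lambda}\subseteq A^1_+$ indexed by a directed set such that $\|a-au_\lambda\|\to 0$ for all $a\in A$. A net is $\ll$-increasing if $u_\lambda\ll u_\mu$ whenever $\lambda\prec\mu$. $A$ is $\ll$-unital if it contains a $\ll$-increasing approximate unit. For an infinite cardinal $\kappa$, $A$ is $\kappa$-unital if it contains an approximate unit of size at most $\kappa$, i.e. one with $|\{u_\lambda:\lambda\in\Lambda\}|\le\kappa$ (equivalently, one can take $|\Lambda|\le\kappa$). $\omega_1$ is the first uncountable cardinal. *)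

(* Defs.v *)
From HB Require Import structures.
From mathcomp Require Import all_boot all_order all_algebra.
From mathcomp Require Import all_classical all_reals topology normedtype.
From mathcomp Require Import wochoice.
From Stdlib Require Import Inverse_Image.
From mathcomp.real_closed Require Import complex.

Set Implicit Arguments.
Unset Strict Implicit.
Unset Printing Implicit Defensive.

Import Order.TTheory GRing.Theory Num.Theory.
Import numFieldNormedType.Exports.

Local Open Scope classical_set_scope.
Local Open Scope card_scope.
Local Open Scope ring_scope.

(* The product is not a MathComp ring product because no unit is assumed: for
   unital algebras the theorem has no content. *)
HB.mixin Record isCStarAlgebra (R : realType) A
    of CompleteNormedModule R[i] A := {
  cmul : A -> A -> A ;
  star : A -> A ;
  cmulA : associative cmul ;
  cmulDl : left_distributive cmul +%R ;
  cmulDr : right_distributive cmul +%R ;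
  cmulZl : forall (k : R[i]) (a b : A), cmul (k *: a) b = k *: cmul a b ;
  cmulZr : forall (k : R[i]) (a b : A), cmul a (k *: b) = k *: cmul a b ;
  starK : involutive star ;
  starD : {morph star : a b / a + b} ;
  starZ : forall (k : R[i]) (a : A), star (k *: a) = k^* *: star a ;
  starM : forall a b : A, star (cmul a b) = cmul (star b) (star a) ;
  cnormM : forall a b : A, `|cmul a b| <= `|a| * `|b| ;
  cstarE : forall a : A, `|cmul (star a) a| = `|a| ^+ 2
}.

#[short(type="cstarAlgType")]
HB.structure Definition CStarAlgebra (R : realType) :=
  {A of isCStarAlgebra R A & CompleteNormedModule R[i] A}.

Reserved Notation "a '**' b" (at level 40, left associativity).
Notation "a '**' b" := (cmul a b) : ring_scope.

Section CStarDefs.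
Context {R : realType} {A : cstarAlgType R}.
Implicit Types a b : A.

Definition positive a : Prop := exists b, a = star b ** b.

Definition positive_unit_ball : set A := [set a | positive a /\ `|a| <= 1].

Definition ll a b : Prop := a = a ** b.

End CStarDefs.

(* Reflexivity is not required; the empty set is allowed, but it supports no
   approximate unit since [tails] then contains no set at all. *)
Definition directed {L : Type} (prec : L -> L -> Prop) : Prop :=
  (forall l m n, prec l m -> prec m n -> prec l n) /\
  (forall l m, exists n, prec l n /\ prec m n).

(* The filter of convergence along a directed set. *)
Definition tails {L : Type} (prec : L -> L -> Prop) : set_system L :=
  filter_from [set: L] (fun l => [set m | prec l m]).

Section Units.
Context {R : realType}.

Definition approximate_unit {A : cstarAlgType R} {L : Type}
    (prec : L -> L -> Prop) (u : L -> A) : Prop :=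
  [/\ directed prec,
      forall l, positive_unit_ball (u l) &
      forall a, `|a - a ** u l| @[l --> tails prec] --> (0 : R[i]^o)].

Definition ll_increasing {A : cstarAlgType R} {L : Type}
    (prec : L -> L -> Prop) (u : L -> A) : Prop :=
  forall l m, prec l m -> ll (u l) (u m).

Definition ll_unital (A : cstarAlgType R) : Prop :=
  exists (L : Type) (prec : L -> L -> Prop) (u : L -> A),
    approximate_unit prec u /\ ll_increasing prec u.

(* A cardinal is represented by any type having that cardinality. *)
Definition cardinal_unital (kappa : Type) (A : cstarAlgType R) : Prop :=
  exists (L : Type) (prec : L -> L -> Prop) (u : L -> A),
    approximate_unit prec u /\ range u #<= [set: kappa].

End Units.

Definition first_uncountable (W : Type) : Prop :=
  ~ countable [set: W] /\
  forall (T : Type) (X : set T), ~ countable X -> [set: W] #<= X.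

(* Such a cardinal exists: take the elements with countably many predecessors
   in a well-ordering of the power set of nat. *)
Lemma first_uncountable_exists : exists W : Type, first_uncountable W.
Proof.
have [le lewo] := well_ordering_principle (set nat).
have min_ex (P : set (set nat)) :
    P !=set0 -> exists2 z, P z & forall x, P x -> le z x.
  move=> [x Px]; have [|z [[zP zmin] _]] := lewo (fun x => `[< P x >]).
    by exists x; apply/asboolP.
  by exists z; [exact/asboolP | move=> y Py; apply: zmin; apply/asboolP].
have lexx : reflexive le.
  by move=> x; have [|z -> zle] := min_ex [set x]; [exists x | exact: zle].
have le_total x y : le x y \/ le y x.
  have [|z /= [] -> zle] := min_ex [set x; y]; first by exists x; left.
    by left; apply: zle; right.
  by right; apply: zle; left.
have le_anti : antisymmetric le.
  move=> x y /andP[xy yx]; have [|z [_ zuniq]] := lewo (pred2 x y).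
    by exists x; rewrite !inE eqxx.
  rewrite -(zuniq x) 1?(zuniq y)//; split; rewrite ?inE ?eqxx ?orbT//.
  - by move=> w /orP[] /eqP ->.
  - by move=> w /orP[] /eqP ->.
pose lt x y := le x y /\ x <> y.
have nltge x y : ~ lt x y -> le y x.
  move=> nlt; have [xy|//] := le_total x y.
  by have [->|xNy] := pselect (x = y); [exact: lexx | case: nlt].
have lt_wf : well_founded lt.
  move=> x; apply: contrapT => nx.
  have [|z nz zmin] := min_ex [set y | ~ Acc lt y]; first by exists x.
  apply: nz; constructor => y [yz yNz]; apply: contrapT => ny.
  by apply: yNz; apply: le_anti; rewrite yz zmin.
pose C := [set x | countable [set y | lt y x]].
have Cunc : ~ countable C.
  move=> Cc; have [CT|/existsNP[x0 nx0]] := pselect (forall x, C x).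
    have /countable_injP[f finj] := Cc.
    have finjT x y : f x = f y -> x = y by apply: finj; rewrite inE.
    pose D : set nat := [set n | exists2 S : set nat, f S = n & ~ S n].
    have [DfD|nDfD] := pselect (D (f D)); last by apply: (nDfD); exists D.
    by case: (DfD) => S /finjT ->; apply.
  have [|z nz zmin] := min_ex (~` C); first by exists x0.
  apply: nz; apply: sub_countable Cc; apply: subset_card_le => y [yz yNz].
  apply: contrapT => nCy; apply: yNz; apply: le_anti.
  by rewrite yz zmin.
pose W := {x | C x}; pose ltW (x y : W) := lt (sval x) (sval y).
have ltW_wf : well_founded ltW by exact: Inverse_Image.wf_inverse_image lt_wf.
have svalW_inj : injective (sval : W -> set nat).
  by move=> [x Cx] [y Cy] /= xy; subst y; congr exist; exact: Prop_irrelevance.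
have ltW_total x y : x <> y -> ltW x y \/ ltW y x.
  move=> xNy; have [xy|/nltge yx] := pselect (ltW x y); [by left|right].
  by split=> // /svalW_inj/esym.
have segW_countable x : countable [set y | ltW y x].
  have /countable_injP[g ginj] := svalP x.
  apply/countable_injP; exists (g \o sval) => y z.
  by rewrite !inE => yx zx gyz; apply/svalW_inj/ginj; rewrite ?inE.
exists W; split=> [Wc|T X Xunc].
  apply: Cunc; apply: sub_countable Wc.
  apply: card_le_trans (card_image_le (sval : W -> set nat) setT).
  by apply: subset_card_le => x Cx; exists (exist _ x Cx).
have [t0 _] : exists t, X t.
  apply: contrapT => nX; apply: Xunc.
  suff -> : X = set0 by exact: countable0.
  by rewrite -subset0 => t Xt; apply: nX; exists t.
pose fresh x (rec : forall y, ltW y x -> T) t :=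
  X t /\ ~ exists y (yx : ltW y x), rec y yx = t.
pose F x rec : T :=
  if pselect (exists t, fresh x rec t) is left e then sval (cid e) else t0.
pose f := Fix ltW_wf (fun=> T) F.
have fE x : f x = F x (fun y _ => f y).
  rewrite /f Fix_eq// => {}x g h gh; congr F.
  by apply: functional_extensionality_dep => y; apply: functional_extensionality_dep.
have f_fresh x : fresh x (fun y _ => f y) (f x).
  rewrite fE /F; case: pselect => [e|nfr]; first by case: cid.
  exfalso; apply: Xunc; apply: sub_countable (segW_countable x).
  apply: card_le_trans (card_image_le f _).
  apply: subset_card_le => t Xt; apply: contrapT => nt.
  by apply: nfr; exists t; split => // -[y [yx yt]]; apply: nt; exists y.
have f_lt x y : ltW x y -> f x <> f y.
  by move=> xy fxy; have [_] := f_fresh y; apply; exists x, xy.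
have f_inj : injective f.
  move=> x y fxy; apply: contrapT => /ltW_total[/f_lt|/f_lt]; first exact.
  by move/esym: fxy => /[swap].
have := @inj_card_eq _ _ setT f (in2W f_inj).
rewrite card_eq_le => /andP[_ /card_le_trans]; apply.
by apply: subset_card_le => _ [x _ <-]; have [] := f_fresh x.
Qed.

(* Main.v *)
(* Only selfadjoint contractions are handled, and squared at the very end.
   Given a <<-increasing sequence [d_n] and a further element [c], there is a
   <<-increasing sequence [e_n] with [d_n << e_n] that approximates a unit for
   [c].  Choose inductively [x_n] with [d_n << x_n] which is almost a unit for
   [c] and for [x_(n-1)]; let [g_n] be the limit over [k] of
     p(g_(n+1)) x_n p(g_(n+1)), where g_(n+1) = p(g_(n+2)) x_(n+1) p(g_(n+2)),
     and so on up to g_k = x_k,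
   for [p(t) = max(2 t^2 - 1, 0)] (below [spike]); and put [e_n = f(g_n)] for
   [f(t) = min(2 t^2, 1)] (below [cap]), followed by a polynomial that brings
   the norm below 1.  Since [f p = p], the [e_n] are <<-increasing, and since
   [p(1) = f(1) = 1], the relations [d_n << x_n] pass on to [d_n << e_n].
   A recursion of length omega_1 then adjoins one element of the given
   approximate unit at a time to a countable <<-directed set; the sets obtained
   before any given stage have a countable <<-directed union.

   The functions [p] and [f] only need the square root of [1 - 4 k], obtained
   from the iteration [h := k + h^2]; norm bounds come from Chebyshev
   polynomials, [T_n(g)] being the real part of the n-th power of the unitary
   [g + i sqrt (1 - g^2)]. *)

Require Import Defs.
From mathcomp Require Import all_boot all_order all_algebra.
From mathcomp Require Import all_classical all_reals all_analysis.
From mathcomp Require Import ring lra.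
From mathcomp Require Import wochoice.
From mathcomp.real_closed Require Import complex.

Set Implicit Arguments.
Unset Strict Implicit.
Unset Printing Implicit Defensive.

Import Order.TTheory GRing.Theory Num.Theory.
Import numFieldNormedType.Exports.
Import ComplexField.

Local Open Scope classical_set_scope.
Local Open Scope complex_scope.
Local Open Scope ring_scope.

(** * Identities in abelian groups *)

Section ZmodSolver.

(** Syntax for a reflective tactic: two sums agree in every abelian group once the integer
    coefficients of all atoms agree, and these are computed. *)
Inductive zmod_expr :=
  | ZVar of nat | ZZero | ZAdd of zmod_expr & zmod_expr | ZOpp of zmod_expr.

Fixpoint zmod_coef (t : zmod_expr) (i : nat) : int :=
  match t with
  | ZVar j => (i == j)%:R
  | ZZero => 0
  | ZAdd t1 t2 => zmod_coef t1 i + zmod_coef t2 i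
  | ZOpp t1 => - zmod_coef t1 i
  end.

Context {V : zmodType}.

Fixpoint zmod_eval (s : seq V) (t : zmod_expr) : V :=
  match t with
  | ZVar j => s`_j
  | ZZero => 0
  | ZAdd t1 t2 => zmod_eval s t1 + zmod_eval s t2
  | ZOpp t1 => - zmod_eval s t1
  end.

Lemma zmod_evalE s t :
  zmod_eval s t = \sum_(0 <= i < size s) s`_i *~ zmod_coef t i.
Proof.
elim: t => [j||t1 IH1 t2 IH2|t1 IH1] /=; rewrite ?IH1 ?IH2.
- have [js|sj] := ltnP j (size s); last first.
    rewrite nth_default// big_nat big1// => i /andP[_ il].
    by rewrite (ltn_eqF (leq_trans il sj)) mulr0z.
  rewrite (bigD1_seq j) ?mem_index_iota ?iota_uniq//= eqxx mulr1z big1 ?addr0//.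
  by move=> i /negPf ->; rewrite mulr0z.
- by rewrite big1// => i _; rewrite mulr0z.
- by rewrite -big_split; apply: eq_bigr => i _; rewrite mulrzDr.
- by rewrite -sumrN; apply: eq_bigr => i _; rewrite mulrNz.
Qed.

Lemma zmod_evalP s t1 t2 :
  all (fun i => zmod_coef t1 i == zmod_coef t2 i) (iota 0 (size s)) ->
  zmod_eval s t1 = zmod_eval s t2.
Proof.
move=> /allP h; rewrite !zmod_evalE; apply: eq_big_seq => i.
by rewrite /index_iota subn0 => /h/eqP ->.
Qed.

End ZmodSolver.

(* Atoms are compared up to unification because the same scalar multiple may
   be displayed with different canonical instances. *)
Ltac zmod_index x s :=
  match s with
  | ?y :: _ => let _ := match goal with _ => unify x y end in constr:(0%N)
  | _ :: ?s' => let n := zmod_index x s' in constr:(S n)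
  end.

Ltac zmod_vars t s :=
  match t with
  | 0 => s
  | ?x + ?y => let s1 := zmod_vars x s in zmod_vars y s1
  | - ?x => zmod_vars x s
  | ?x => match s with
          | _ => let _ := zmod_index x s in s
          | _ => constr:(x :: s)
          end
  end.

Ltac zmod_reify t s :=
  match t with
  | 0 => constr:(ZZero)
  | ?x + ?y =>
    let t1 := zmod_reify x s in let t2 := zmod_reify y s in constr:(ZAdd t1 t2)
  | - ?x => let t1 := zmod_reify x s in constr:(ZOpp t1)
  | ?x => let n := zmod_index x s in constr:(ZVar n)
  end.

Ltac zmod :=
  rewrite ?mulr2n;
  lazymatch goal with |- @eq ?V ?x ?y =>
    let s0 := zmod_vars x (@nil V) in
    let s := zmod_vars y s0 in
    let t1 := zmod_reify x s in
    let t2 := zmod_reify y s in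
    let h := fresh in
    have h := @zmod_evalP _ s t1 t2; refine (h _); vm_compute; reflexivity
  end.

(** * Real-valued norm, adjoints and completeness *)

Section Algebra.
Context {R : realType} {A : cstarAlgType R}.
Implicit Types (a b c d e f g k x : A) (eps : R).

Lemma cmul0l b : 0 ** b = 0 :> A.
Proof. by apply: (addIr (0 ** b)); rewrite -cmulDl !add0r. Qed.

Lemma cmul0r b : b ** 0 = 0 :> A.
Proof. by apply: (addIr (b ** 0)); rewrite -cmulDr !add0r. Qed.

Lemma cmulNl a b : - a ** b = - (a ** b).
Proof. by rewrite -scaleN1r cmulZl scaleN1r. Qed.

Lemma cmulNr a b : a ** - b = - (a ** b).
Proof. by rewrite -scaleN1r cmulZr scaleN1r. Qed.

Lemma cmulBl a b c : (a - b) ** c = a ** c - b ** c.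
Proof. by rewrite cmulDl cmulNl. Qed.

Lemma cmulBr a b c : a ** (b - c) = a ** b - a ** c.
Proof. by rewrite cmulDr cmulNr. Qed.

Lemma star0 : star 0 = 0 :> A.
Proof. by apply: (addIr (star 0)); rewrite -starD !add0r. Qed.

Lemma starN a : star (- a) = - star a.
Proof. by rewrite -scaleN1r starZ rmorphN rmorph1 scaleN1r. Qed.

Lemma starB a b : star (a - b) = star a - star b.
Proof. by rewrite starD starN. Qed.

(** The norm of a module over [R[i]] takes values in [R[i]]; its real part brings estimates within
    reach of [lra] and [nra]. *)
Definition nrm a : R := complex.Re `|a|.

Lemma normE a : `|a| = (nrm a)%:C.
Proof. by rewrite /nrm RRe_real// ger0_real. Qed.

Lemma nrm_ge0 a : 0 <= nrm a.
Proof. by rewrite -lecR -normE normr_ge0. Qed.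

Lemma nrmD a b : nrm (a + b) <= nrm a + nrm b.
Proof. by rewrite -lecR rmorphD /= -!normE ler_normD. Qed.

Lemma nrmN a : nrm (- a) = nrm a.
Proof. by rewrite /nrm normrN. Qed.

Lemma nrmB a b : nrm (a - b) <= nrm a + nrm b.
Proof. by rewrite -(nrmN b) nrmD. Qed.

Lemma nrmBC a b : nrm (a - b) = nrm (b - a).
Proof. by rewrite -nrmN opprB. Qed.

Lemma nrm_eq0 a : nrm a <= 0 -> a = 0.
Proof.
move=> a0; apply/eqP; rewrite -normr_eq0 normE.
by rewrite (_ : nrm a = 0)//; apply/eqP; rewrite eq_le a0 nrm_ge0.
Qed.

Lemma nrm0 : nrm 0 = 0.
Proof. by rewrite /nrm normr0. Qed.

Lemma nrmZ (r : R) a : nrm (r%:C *: a) = `|r| * nrm a.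
Proof.
apply: complexI; rewrite -normE normrZ rmorphM /= -normE; congr (_ * _).
by rewrite normc_def /= expr0n addr0 sqrtr_sqr.
Qed.

Lemma nrmM a b : nrm (a ** b) <= nrm a * nrm b.
Proof. by rewrite -lecR rmorphM /= -!normE cnormM. Qed.

Lemma nrm_star_mul a : nrm (star a ** a) = nrm a ^+ 2.
Proof. by apply: complexI; rewrite rmorphXn /= -!normE cstarE. Qed.

(** By the C*-identity [|b|^2 = |b^* b| <= |b^*| |b|]; cancel [|b|], then apply this to [b^*] as
    well. *)
Lemma nrm_star a : nrm (star a) = nrm a.
Proof.
suff h b : nrm b <= nrm (star b).
  by apply/eqP; rewrite eq_le (h a) -{2}(starK a) h.
have [->|b0] := eqVneq (nrm b) 0; first exact: nrm_ge0.
have bp : 0 < nrm b by rewrite lt_neqAle eq_sym b0 nrm_ge0.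
by rewrite -(ler_pM2r bp) -expr2 -nrm_star_mul nrmM.
Qed.

Lemma nrm_mul2n (n : nat) a : nrm (a *+ n) = nrm a *+ n.
Proof.
rewrite -scaler_nat -(rmorph_nat (@real_complex R)) nrmZ ger0_norm//.
by rewrite mulr_natl.
Qed.

Lemma nrm_small a (C : R) :
  (forall eps, 0 < eps -> nrm a <= C * eps) -> a = 0.
Proof.
move=> h; apply: nrm_eq0; apply/ler_addgt0Pr => e e0; rewrite add0r.
have Cp : 0 < `|C| + 1 by rewrite ltr_wpDl.
have /h/le_trans : 0 < e / (`|C| + 1) by exact: divr_gt0.
apply; rewrite mulrCA -[leRHS]mulr1 ler_pM2l// ler_pdivrMr// mul1r.
by rewrite (le_trans (ler_norm C))// lerDl.
Qed.

(** The increments telescope, so every term after [v n] is within [rho n] of it, and the limit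
    inherits this explicit rate. *)
Lemma telescoping_limit (v : nat -> A) (rho : nat -> R) :
  (forall n, 0 <= rho n) ->
  (forall eps, 0 < eps -> exists n, rho n < eps) ->
  (forall n, nrm (v n.+1 - v n) <= rho n - rho n.+1) ->
  exists l, forall n, nrm (l - v n) <= rho n.
Proof.
move=> rho_ge0 rho_small vrho.
have vB n m : nrm (v (n + m)%N - v n) <= rho n - rho (n + m)%N.
  elim: m => [|m IH]; first by rewrite addn0 !subrr nrm0.
  rewrite addnS -(subrKA (v (n + m)%N)) (le_trans (nrmD _ _))//.
  by have := vrho (n + m)%N; lra.
have cv : cvg (v @ \oo).
  apply/cauchy_cvgP/cauchy_ballP => eps eps0.
  have e0 : 0 < complex.Re eps by rewrite -ltcR RRe_real ?gtr0_real.
  have [n rn] := rho_small _ (divr_gt0 e0 (ltr0n _ 2)).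
  pose U := v @` [set m | (n <= m)%N].
  have FU : (v @ \oo) U by exists n => // m nm; exists m.
  exists (U, U) => //= -[_ _] /= [[i ni <-] [j nj <-]].
  rewrite -ball_normE /= normE -(RRe_real (gtr0_real eps0)) ltcR.
  rewrite -(subrKA (v n)) (le_lt_trans (nrmD _ _))// (nrmBC (v n)).
  have := vB n (i - n)%N; have := vB n (j - n)%N; rewrite !subnKC//.
  have := rho_ge0 i; have := rho_ge0 j; lra.
exists (lim (v @ \oo)) => n; apply/ler_addgt0Pr => e e0.
have /cvgrPdist_lt/(_ e%:C) := cv; rewrite ltcR => /(_ e0)[m _ hm].
have := hm (n + m)%N (leq_addl _ _); rewrite /= normE ltcR => h.
rewrite -(subrKA (v (n + m)%N)) (le_trans (nrmD _ _))//.
by have := vB n m; have := rho_ge0 (n + m)%N; lra.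
Qed.

End Algebra.

Lemma starZr {R : realType} {A : cstarAlgType R} (r : R) (a : A) :
  star (r%:C *: a) = r%:C *: star a.
Proof. by rewrite starZ; congr (_ *: _); exact: conjc_real. Qed.

Lemma half_double {R : realType} {A : cstarAlgType R} (a : A) :
  (2^-1)%:C *: (a *+ 2) = a.
Proof.
rewrite -[a *+ 2]scaler_nat scalerA -(rmorph_nat (@real_complex R)) -rmorphM /=.
by rewrite mulVf// scale1r.
Qed.

(** * Square roots by fixed-point iteration *)

Section SquareRoot.
Context {R : realType} {A : cstarAlgType R}.
Implicit Types (a b c d k h x : A) (eps : R).

Lemma cmulBB a b c d :
  a ** c - b ** d = a ** (c - d) + (a - b) ** d :> A.
Proof. by rewrite cmulBr cmulBl subrKA. Qed.

(** The worst case [k = 1/4] of [half_root_iter], a majorant whenever [nrm k <= 1/4]. It increases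
    to [1/2], the double root of [t = 1/4 + t^2]. *)
Fixpoint half_root_scalar n : R :=
  if n is n'.+1 then 4^-1 + half_root_scalar n' ^+ 2 else 0.

Lemma half_root_scalar_ge0 n : 0 <= half_root_scalar n.
Proof. by case: n => //= n; rewrite addr_ge0 ?sqr_ge0// invr_ge0. Qed.

Definition half_root_gap n : R := 2^-1 - half_root_scalar n.

Lemma half_root_gap_ge0 n : 0 <= half_root_gap n.
Proof.
rewrite /half_root_gap; elim: n => /= [|n]; first lra.
by have := half_root_scalar_ge0 n; nra.
Qed.

(** The gap [r] evolves by [r - r^2]. As [t - t^2] increases on [[0, 1/2]], [r <= 1/N] yields
    [r - r^2 <= 1/N - 1/N^2 <= 1/(N + 1)]. *)
Lemma half_root_gap_le n : half_root_gap n <= n.+2%:R^-1.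
Proof.
rewrite /half_root_gap; elim: n => [|n IH] /=; first lra.
set r := 2^-1 - half_root_scalar n in IH.
have -> : 2^-1 - (4^-1 + half_root_scalar n ^+ 2) = r - r ^+ 2.
  by rewrite /r; field.
have n2 : 0 < n.+2%:R :> R by [].
have n3 : n.+3%:R = n.+2%:R + 1 :> R by rewrite [in LHS]mulrS addrC.
set N : R := n.+2%:R in IH n2 n3 *.
have NV : N^-1 <= 2^-1 by rewrite lef_pV2 ?posrE ?ler_nat.
apply: (@le_trans _ _ (N^-1 - N^-1 ^+ 2)).
  move: (N^-1) IH NV; move: r => r i ri i2.
  suff : 0 <= (i - r) * (1 - r - i) by lra.
  by rewrite mulr_ge0//; lra.
rewrite n3 -[leRHS]mul1r ler_pdivlMr; last lra.
have -> : (N^-1 - N^-1 ^+ 2) * (N + 1) = 1 - N^-1 ^+ 2 by field; lra.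
by rewrite lerBlDr lerDl sqr_ge0.
Qed.

Lemma half_root_gap_small eps : 0 < eps -> exists n, half_root_gap n < eps.
Proof.
move=> e0; exists (Num.truncn eps^-1).
rewrite (le_lt_trans (half_root_gap_le _))// invf_plt ?posrE//.
by rewrite (lt_trans (truncnS_gt _))// ltr_nat.
Qed.

Fixpoint half_root_iter k (n : nat) : A :=
  if n is n'.+1 then k + half_root_iter k n' ** half_root_iter k n' else 0.

(* The half-root [h = (1 - sqrt (1 - 4 k)) / 2] lies in [A] although [A] has
   no unit; it solves [h = k + h ^ 2]. *)
Definition half_root k : A :=
  xget 0 [set h | forall n, nrm (h - half_root_iter k n) <= half_root_gap n].

Lemma nrm_half_root_iter k n :
  nrm k <= 4^-1 -> nrm (half_root_iter k n) <= half_root_scalar n.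
Proof.
move=> kle; elim: n => /= [|n IH]; first by rewrite nrm0.
rewrite (le_trans (nrmD _ _))// lerD// (le_trans (nrmM _ _))// expr2.
by rewrite ler_pM// nrm_ge0.
Qed.

(** Apply [a c - b d = a (c - d) + (a - b) d] to both iterations: inductively, the scalar increments
    dominate those in [A]. *)
Lemma half_root_iter_cauchy k n : nrm k <= 4^-1 ->
  nrm (half_root_iter k n.+1 - half_root_iter k n)
    <= half_root_gap n - half_root_gap n.+1.
Proof.
move=> kle; have -> : half_root_gap n - half_root_gap n.+1 =
    half_root_scalar n.+1 - half_root_scalar n by rewrite /half_root_gap; ring.
elim: n => [|n IH]; first by rewrite /= cmul0l expr0n !addr0 !subr0.
have -> : half_root_iter k n.+2 - half_root_iter k n.+1 =
    half_root_iter k n.+1 ** half_root_iter k n.+1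
    - half_root_iter k n ** half_root_iter k n.
  by rewrite /= opprD addrACA subrr add0r.
have -> : half_root_scalar n.+2 - half_root_scalar n.+1 =
  half_root_scalar n.+1 * (half_root_scalar n.+1 - half_root_scalar n) +
  (half_root_scalar n.+1 - half_root_scalar n) * half_root_scalar n.
  rewrite -[half_root_scalar n.+2]/(4^-1 + half_root_scalar n.+1 ^+ 2).
  have : half_root_scalar n.+1 = 4^-1 + half_root_scalar n ^+ 2 by [].
  by move: (half_root_scalar n.+1) (half_root_scalar n) => s t st; ring: st.
rewrite cmulBB (le_trans (nrmD _ _))// lerD//.
- by rewrite (le_trans (nrmM _ _))// ler_pM ?nrm_ge0// nrm_half_root_iter.
- by rewrite (le_trans (nrmM _ _))// ler_pM ?nrm_ge0// nrm_half_root_iter.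
Qed.

Lemma half_root_approx k n : nrm k <= 4^-1 ->
  nrm (half_root k - half_root_iter k n) <= half_root_gap n.
Proof.
move=> kle; move: n; rewrite /half_root; case: xgetP => [h -> //|nh].
have [h hP] := telescoping_limit half_root_gap_ge0 half_root_gap_small
  (fun n => half_root_iter_cauchy n kle).
by case: (nh h).
Qed.

Lemma nrm_half_root k : nrm k <= 4^-1 -> nrm (half_root k) <= 2^-1.
Proof.
move=> kle; rewrite -(subrK (half_root_iter k 0) (half_root k)).
have := half_root_approx 0 kle; have := nrm_half_root_iter 0 kle.
by have := nrmD (half_root k - half_root_iter k 0) (half_root_iter k 0);
  rewrite /half_root_gap; lra.
Qed.

Lemma half_rootE k : nrm k <= 4^-1 ->
  half_root k = k + half_root k ** half_root k.
Proof.
move=> kle; apply/subr0_eq/(nrm_small (C := 2)) => e e0.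
have [n ne] := half_root_gap_small e0.
set h := half_root k; set r := half_root_iter k n.
have -> : h - (k + h ** h) = (h - half_root_iter k n.+1) + (r ** r - h ** h).
  by rewrite /= -/r; zmod.
have rh : nrm (r - h) <= half_root_gap n by rewrite nrmBC half_root_approx.
have := half_root_approx n.+1 kle; rewrite -/h.
have := nrmD (h - half_root_iter k n.+1) (r ** r - h ** h).
have := nrmD (r ** (r - h)) ((r - h) ** h); rewrite -cmulBB.
have : nrm (r ** (r - h)) <= half_root_scalar n * half_root_gap n.
  rewrite (le_trans (nrmM _ _))// ler_pM ?nrm_ge0//.
  exact: nrm_half_root_iter.
have : nrm ((r - h) ** h) <= half_root_gap n * 2^-1.
  by rewrite (le_trans (nrmM _ _))// ler_pM ?nrm_ge0// nrm_half_root.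
have := half_root_gap_ge0 n; have := half_root_scalar_ge0 n.
have := half_root_gap_ge0 n.+1; rewrite /half_root_gap /=.
move: ne; rewrite /half_root_gap; nra.
Qed.

Lemma half_root_comm k x : nrm k <= 4^-1 ->
  x ** k = k ** x -> x ** half_root k = half_root k ** x.
Proof.
move=> kle xk; apply/subr0_eq/(nrm_small (C := 2 * nrm x)) => e e0.
have [n ne] := half_root_gap_small e0.
set h := half_root k; set r := half_root_iter k n.
have xr : x ** r = r ** x.
  rewrite /r; elim: n {ne r} => /= [|n IH]; first by rewrite cmul0l cmul0r.
  by rewrite cmulDr cmulDl xk cmulA IH -cmulA IH cmulA.
have -> : x ** h - h ** x = x ** (h - r) - (h - r) ** x.
  by rewrite cmulBr cmulBl xr; zmod.
have hr := half_root_approx n kle; rewrite -/h -/r in hr.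
rewrite (le_trans (nrmB _ _))//; have x0 := nrm_ge0 x.
have := nrmM x (h - r); have := nrmM (h - r) x.
by have := nrm_ge0 (h - r); nra.
Qed.

Lemma half_root_star k : nrm k <= 4^-1 -> star k = k ->
  star (half_root k) = half_root k.
Proof.
move=> kle ks; apply/subr0_eq/(nrm_small (C := 2)) => e e0.
have [n ne] := half_root_gap_small e0.
set h := half_root k; set r := half_root_iter k n.
have rs : star r = r.
  rewrite /r; elim: n {ne r} => /= [|n IH]; first by rewrite star0.
  by rewrite starD starM ks IH.
have -> : star h - h = star (h - r) - (h - r) by rewrite starB rs; zmod.
rewrite (le_trans (nrmB _ _))// nrm_star.
by have := half_root_approx n kle; rewrite -/h -/r; lra.
Qed.

Lemma half_root_iter_lipschitz k k' n : nrm k <= 4^-1 -> nrm k' <= 4^-1 ->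
  nrm (half_root_iter k n - half_root_iter k' n) <= n%:R * nrm (k - k').
Proof.
move=> kle kle'; elim: n => /= [|n IH]; first by rewrite subrr nrm0 mul0r.
have := nrm_half_root_iter n kle; have := nrm_half_root_iter n kle'.
move: (half_root_iter k n) (half_root_iter k' n) IH => r r' IH nr' nr.
have -> : k + r ** r - (k' + r' ** r') = (k - k') + (r ** r - r' ** r') by zmod.
rewrite cmulBB (le_trans (nrmD _ _))// -natr1 mulrDl mul1r addrC lerD2r.
rewrite (le_trans (nrmD _ _))//; have := nrmM r (r - r').
have := nrmM (r - r') r'; have := nrm_ge0 (r - r').
have := half_root_gap_ge0 n; rewrite /half_root_gap; nra.
Qed.

(** The iterates converge uniformly on the ball of radius [1/4], and the [n]-th has Lipschitz
    constant [n], since squaring is 1-Lipschitz on the ball of radius [1/2]. *)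
Lemma half_root_continuous eps : 0 < eps -> exists2 del, 0 < del &
  forall k k', nrm k <= 4^-1 -> nrm k' <= 4^-1 -> nrm (k - k') < del ->
  nrm (half_root k - half_root k') < eps.
Proof.
move=> e0; have [|n ne] := @half_root_gap_small (eps / 4); first lra.
have n0 : 0 <= n%:R :> R by [].
exists (eps / 4 / (n%:R + 1)) => [|k k' kle kle' kk'].
  by apply: divr_gt0; lra.
have := half_root_iter_lipschitz n kle kle'.
have := half_root_approx n kle; have := half_root_approx n kle'.
set h := half_root k; set h' := half_root k'.
set r := half_root_iter k n; set r' := half_root_iter k' n => hr' hr rr'.
have -> : h - h' = (h - r) + (r - r') - (h' - r') by zmod.
have := nrmB (h - r + (r - r')) (h' - r'); have := nrmD (h - r) (r - r').
suff : n%:R * nrm (k - k') <= eps / 4 by lra.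
move: kk'; rewrite ltr_pdivlMr; last lra.
by have := nrm_ge0 (k - k'); nra.
Qed.

End SquareRoot.

(** * Chebyshev polynomials of selfadjoint contractions *)

Section Chebyshev.
Context {R : realType} {A : cstarAlgType R}.
Implicit Types (a b c e g : A) (z : R[i]).

Definition sa_contraction g := star g = g /\ nrm g <= 1.

(** This is [T_n(g) b]: without a unit, polynomials with a constant term exist only as operators on
    [A]. *)
Fixpoint chebyshev g (n : nat) b : A :=
  match n with
  | 0 => b
  | 1 => g ** b
  | (n'.+1 as m).+1 => (g ** chebyshev g m b) *+ 2 - chebyshev g n' b
  end.

(* For [z = 'i] this is multiplication by the unitary [g + i sqrt (1 - g^2)]
   of the unitization. *)
Let cosqrt g b := b - (half_root ((4^-1)%:C *: (g ** g)) ** b) *+ 2.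
Let rotate g z b := g ** b + z *: cosqrt g b.

Section Rotation.
Context (g : A) (g_sac : sa_contraction g).
Let gs : star g = g := g_sac.1.
Let k := (4^-1)%:C *: (g ** g).
Let h := half_root k.

Let kle : nrm k <= 4^-1.
Proof.
rewrite nrmZ ger0_norm ?invr_ge0// -[leRHS]mulr1 ler_pM2l ?invr_gt0//.
rewrite (le_trans (nrmM _ _))// -[leRHS]mulr1 ler_pM ?nrm_ge0//; exact: g_sac.2.
Qed.

Let k4 : k *+ 4 = g ** g.
Proof.
rewrite -scaler_nat scalerA -(rmorph_nat (@real_complex R)) -rmorphM /= mulfV//.
by rewrite scale1r.
Qed.

Let hE : h = k + h ** h. Proof. exact: half_rootE. Qed.

Let hs : star h = h.
Proof. by apply: half_root_star; rewrite // starZr starM gs. Qed.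

Let gh : g ** h = h ** g.
Proof. by apply: half_root_comm; rewrite // cmulZl cmulZr cmulA. Qed.

Let cosqrtD b c : cosqrt g (b + c) = cosqrt g b + cosqrt g c.
Proof. by rewrite /cosqrt cmulDr; zmod. Qed.

Let cosqrtZ z b : cosqrt g (z *: b) = z *: cosqrt g b.
Proof. by rewrite /cosqrt cmulZr scalerBr scalerMnr. Qed.

Let cosqrtM b : cosqrt g (g ** b) = g ** cosqrt g b.
Proof. by rewrite /cosqrt cmulBr !mulr2n cmulDr !cmulA -/k -/h gh. Qed.

(** [cosqrt g] acts as [1 - 2 h], and [(1 - 2 h)^2 = 1 - 4 (h - h^2) = 1 - 4 k = 1 - g^2]. *)
Let cosqrtK b : cosqrt g (cosqrt g b) = b - g ** (g ** b).
Proof.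
rewrite cmulA -k4 (_ : k = h - h ** h); last by rewrite {1}hE addrK.
rewrite /cosqrt -/k -/h !mulrS !mulr0n !addr0.
by rewrite !(cmulDl, cmulDr, cmulNr, cmulNl) -!cmulA; zmod.
Qed.

Let rotateD z b c : rotate g z (b + c) = rotate g z b + rotate g z c.
Proof. by rewrite /rotate cmulDr cosqrtD scalerDr addrACA. Qed.

Let rotateK z : z * z = -1 -> cancel (rotate g z) (rotate g (- z)).
Proof.
move=> z2 b; rewrite /rotate cosqrtD cosqrtZ cosqrtM cosqrtK cmulDr cmulZr.
rewrite scalerDr scalerA !scaleNr mulNr z2 opprK scale1r.
by zmod.
Qed.

Let star_rotate z b c :
  star (rotate g z b) ** c = star b ** rotate g z^* c.
Proof.
rewrite /rotate /cosqrt -/k -/h starD starZ starB mulr2n starD !starM gs hs.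
by rewrite !(cmulDl, cmulDr, cmulZl, cmulZr, cmulNr, cmulNl, mulr2n) -!cmulA.
Qed.

(** If [u] denotes the rotation, then [u^* u = 1] and [|u b|^2 = |b^* u^* u b| = |b|^2]. *)
Let nrm_rotate z b : z * z = -1 -> z^* = - z -> nrm (rotate g z b) = nrm b.
Proof.
move=> z2 zc; apply/eqP; rewrite -(eqrXn2 (n := 2)) ?nrm_ge0//.
by rewrite -!nrm_star_mul star_rotate zc rotateK.
Qed.

Let rotate_sum b : rotate g 'i b + rotate g (- 'i) b = (g ** b) *+ 2.
Proof. by rewrite /rotate scaleNr; zmod. Qed.

Let ii : 'i * 'i = -1 :> R[i]. Proof. exact: sqr_i. Qed.

Let chebyshevE n b : chebyshev g n b *+ 2 =
  iter n (rotate g 'i) b + iter n (rotate g (- 'i)) b.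
Proof.
(* The recursion reaches back two terms, so the induction carries two consecutive indices; its step
   rests on [u + u^-1 = 2 g]. *)
suff [] : chebyshev g n b *+ 2 =
    iter n (rotate g 'i) b + iter n (rotate g (- 'i)) b /\
  chebyshev g n.+1 b *+ 2 =
    iter n.+1 (rotate g 'i) b + iter n.+1 (rotate g (- 'i)) b by [].
elim: n => [|n [IH1 IH2]]; first by rewrite /= rotate_sum.
split=> //; rewrite -[chebyshev g n.+2 b]/(_ *+ 2 - chebyshev g n b).
have -> : (g ** chebyshev g n.+1 b *+ 2 - chebyshev g n b) *+ 2 =
    g ** (chebyshev g n.+1 b *+ 2) *+ 2 - chebyshev g n b *+ 2.
  by rewrite mulrnBl [in RHS]mulr2n cmulDr -mulr2n.
rewrite IH1 IH2 cmulDr mulrnDl -!rotate_sum !iterS.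
have := @rotateK (- 'i); rewrite mulrNN opprK => /(_ ii) rotateKN.
by rewrite (rotateK ii) rotateKN; zmod.
Qed.

Lemma nrm_chebyshev n b : nrm (chebyshev g n b) <= nrm b.
Proof.
have it z m : z * z = -1 -> z^* = - z -> nrm (iter m (rotate g z) b) = nrm b.
  by move=> z2 zc; elim: m => //= m IH; rewrite nrm_rotate.
have : nrm (chebyshev g n b *+ 2) <= nrm b *+ 2.
  have conj_i : 'i^* = - 'i :> R[i].
    by apply/eqP; rewrite eq_complex /= oppr0 !eqxx.
  rewrite chebyshevE (le_trans (nrmD _ _))//.
  have conj_Ni : (- 'i)^* = - - 'i :> R[i] by rewrite rmorphN /= conj_i.
  by rewrite (it _ _ ii conj_i) (it _ _ _ conj_Ni) ?mulrNN ?mulr2n.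
by rewrite nrm_mul2n lerMn2r.
Qed.

End Rotation.

(** Test on [b = c]: [|c|^2 = |c c| <= M |c|]. *)
Lemma nrm_le_op c (M : R) :
  star c = c -> 0 <= M -> (forall b, nrm (c ** b) <= M * nrm b) -> nrm c <= M.
Proof.
move=> cs M0 cM; have [c0|c0] := leP (nrm c) 0; first exact: le_trans c0 M0.
by rewrite -(ler_pM2r c0) -expr2 -nrm_star_mul cs cM.
Qed.

Lemma chebyshev2E g b : chebyshev g 2 b = (g ** (g ** b)) *+ 2 - b.
Proof. by []. Qed.

(** [1 - g^2 = (1 - T_2(g)) / 2]. *)
Lemma nrm_sub_sqr g b : sa_contraction g -> nrm (b - g ** (g ** b)) <= nrm b.
Proof.
move=> gc; have := nrm_chebyshev gc 2 b; rewrite chebyshev2E => h.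
have -> : b - g ** (g ** b) = (2^-1)%:C *: (b - (g ** (g ** b) *+ 2 - b)).
  by rewrite opprB addrA -mulr2n -mulrnBl half_double.
rewrite nrmZ ger0_norm ?invr_ge0//.
by have := nrmB b (g ** (g ** b) *+ 2 - b); lra.
Qed.

(* [cut_poly e] evaluates [t |-> (3 t - t^3) / 2 = - T_3 (t / 2)], which maps
   [[-2, 2]] into [[-1, 1]] and fixes [0] and [1]. *)
Definition cut_poly e : A := (2^-1)%:C *: (e *+ 3 - e ** (e ** e)).

Lemma star_cut_poly e : star e = e -> star (cut_poly e) = cut_poly e.
Proof.
move=> es; rewrite /cut_poly starZr starB !mulrS mulr0n !starD !starM.
by rewrite es star0 cmulA.
Qed.

Lemma cut_poly_sac e : star e = e -> nrm e <= 2 -> sa_contraction (cut_poly e).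
Proof.
move=> es e2; split; first exact: star_cut_poly.
pose g := (2^-1)%:C *: e; have gc : sa_contraction g.
  split; first by rewrite starZr es.
  by rewrite nrmZ ger0_norm ?invr_ge0//; lra.
have eg : e = g *+ 2 by rewrite -[LHS]half_double scalerMnr.
have cutE : cut_poly e = g *+ 3 - (g ** (g ** g)) *+ 4.
  rewrite /cut_poly -[RHS]half_double eg !mulrS !mulr0n !addr0.
  by rewrite !(cmulDl, cmulDr); congr (_ *: _); zmod.
apply: nrm_le_op => // [|b]; first exact: star_cut_poly.
rewrite mul1r; have := nrm_chebyshev gc 3 b; congr (_ <= _).
rewrite -nrmN; congr nrm.
rewrite -[chebyshev g 3 b]/((g ** (g ** (g ** b) *+ 2 - b)) *+ 2 - g ** b).
rewrite cutE !mulrS !mulr0n !addr0.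
by rewrite !(cmulDl, cmulDr, cmulNl, cmulNr) -!cmulA; zmod.
Qed.

(** Factor [1 - (3 t - t^3) / 2 = (2 - t - t^2) (1 - t) / 2] and bound the first factor termwise. *)
Lemma cut_polyB e b : nrm e <= 2 ->
  nrm (b - cut_poly e ** b) <= 9 * nrm (b - e ** b).
Proof.
move=> e2; set c := b - e ** b.
have -> : b - cut_poly e ** b =
    (2^-1)%:C *: (c *+ 2 - e ** c - e ** (e ** c)).
  rewrite /cut_poly cmulZl -[b in b - _]half_double -scalerBr /c.
  rewrite !mulrS !mulr0n !addr0.
  by rewrite !(cmulDl, cmulDr, cmulNl, cmulNr) -!cmulA; congr (_ *: _); zmod.
rewrite nrmZ ger0_norm ?invr_ge0//.
have := nrmB (c *+ 2 - e ** c) (e ** (e ** c)).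
have := nrmB (c *+ 2) (e ** c); rewrite nrm_mul2n.
have ec : nrm (e ** c) <= 2 * nrm c.
  by rewrite (le_trans (nrmM _ _))// ler_wpM2r ?nrm_ge0.
have : nrm (e ** (e ** c)) <= 2 * (2 * nrm c).
  by rewrite (le_trans (nrmM _ _))// ler_pM ?nrm_ge0.
have := nrm_ge0 c; lra.
Qed.

End Chebyshev.

(** * Truncations *)

Section Truncation.
Context {R : realType} {A : cstarAlgType R}.
Implicit Types (a b c d e f g k x : A) (eps : R).

Lemma nrm_sac_mul g b : sa_contraction g -> nrm (g ** b) <= nrm b.
Proof.
move=> [_ g1]; rewrite (le_trans (nrmM _ _))// -[leRHS]mul1r.
by rewrite ler_wpM2r ?nrm_ge0.
Qed.

Lemma nrm_mul_sac g b : sa_contraction g -> nrm (b ** g) <= nrm b.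
Proof.
move=> [_ g1]; rewrite (le_trans (nrmM _ _))// -[leRHS]mulr1.
by rewrite ler_wpM2l ?nrm_ge0.
Qed.

(* At [t = g]: [half_bend], [cap] and [spike] evaluate
   [(1 - |1 - 2 t^2|) / 2], [min (2 t^2) 1] and [max (2 t^2 - 1) 0]. *)
Definition bend_arg g := g ** g - (g ** g) ** (g ** g).
Definition half_bend g := half_root (bend_arg g).
Definition cap g := g ** g + half_bend g.
Definition spike g := g ** g - half_bend g.

(** As [h = k + h^2], the defect [h - f h] equals its own product with [h]; [nrm h <= 1/2] forces it
    to vanish. *)
Lemma half_root_fixed k f : nrm k <= 4^-1 ->
  f ** k = k -> f ** half_root k = half_root k.
Proof.
move=> kle fk; set h := half_root k; apply/esym/subr0_eq/nrm_eq0.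
have hE : h = k + h ** h by exact: half_rootE.
have hfh : h - f ** h = (h - f ** h) ** h.
  by rewrite {1 2}hE cmulDr fk cmulBl -cmulA; zmod.
have := nrmM (h - f ** h) h; rewrite -hfh.
by have := nrm_half_root kle; rewrite -/h; have := nrm_ge0 (h - f ** h); nra.
Qed.

(** In [h b = k b + h (h b)] the last term is absorbed because [nrm h <= 1/2]. *)
Lemma nrm_half_root_mul k b : nrm k <= 4^-1 ->
  nrm (half_root k ** b) <= 2 * nrm (k ** b).
Proof.
move=> kle; set h := half_root k.
have hb : h ** b = k ** b + h ** (h ** b).
  by rewrite cmulA -cmulDl -half_rootE.
have := nrmD (k ** b) (h ** (h ** b)); rewrite -hb.
have := nrmM h (h ** b); have := nrm_half_root kle; rewrite -/h.
by have := nrm_ge0 (h ** b); nra.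
Qed.

(** [8 (t^2 - t^4) = 1 - T_4(t)], and the right side acts with norm at most 2. *)
Lemma nrm_bend_arg g : sa_contraction g -> nrm (bend_arg g) <= 4^-1.
Proof.
move=> gc; have [gs _] := gc; apply: nrm_le_op => [||b]; rewrite ?invr_ge0//.
  by rewrite starB !starM gs.
have h : nrm ((bend_arg g ** b) *+ 8) <= nrm b *+ 2.
  have -> : (bend_arg g ** b) *+ 8 = b - chebyshev g 4 b.
    rewrite /= /bend_arg !mulrS !mulr0n !addr0.
    by rewrite !(cmulDl, cmulDr, cmulNl, cmulNr) -!cmulA; zmod.
  by rewrite (le_trans (nrmB _ _))// mulr2n lerD2l nrm_chebyshev.
by move: h; rewrite nrm_mul2n; lra.
Qed.

Lemma star_half_bend g : sa_contraction g -> star (half_bend g) = half_bend g.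
Proof.
move=> gc; have [gs _] := gc; apply: half_root_star; first exact: nrm_bend_arg.
by rewrite starB !starM gs.
Qed.

Lemma star_cap g : sa_contraction g -> star (cap g) = cap g.
Proof. by move=> gc; rewrite starD starM gc.1 star_half_bend. Qed.

(** With [q = g^2] and [h = half_bend g], which commute, [h = q - q^2 + h^2] reads
    [q - h = (q + h) (q - h)]. *)
Lemma cap_spike g : sa_contraction g -> cap g ** spike g = spike g.
Proof.
move=> gc; have kle := nrm_bend_arg gc; rewrite /cap /spike.
have hE := half_rootE kle; rewrite -/(half_bend g) {1}/bend_arg in hE.
have qh : (g ** g) ** half_bend g = half_bend g ** (g ** g).
  by apply: half_root_comm => //; rewrite cmulBl cmulBr !cmulA.
set h := half_bend g in hE qh *; set q := g ** g in hE qh *.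
rewrite cmulDl !cmulBr qh [in RHS]hE; zmod.
Qed.

(** From [p = 2 g^2 - cap g] and [cap_spike], [p^2 = T_2(g) p]; hence [|p|^2 <= |p|]. *)
Lemma spike_sac g : sa_contraction g -> sa_contraction (spike g).
Proof.
move=> gc; set p := spike g.
have ps : star p = p by rewrite starB starM gc.1 star_half_bend.
split=> //; have pp : p ** p = chebyshev g 2 p.
  have pE : p = (g ** g) *+ 2 - cap g by rewrite /p /spike /cap; zmod.
  rewrite chebyshev2E {1}pE cmulBl cap_spike// -/p.
  by rewrite !mulr2n cmulDl -!cmulA.
have [p0|p0] := leP (nrm p) 0; first exact: le_trans p0 ler01.
rewrite -(ler_pM2r p0) -expr2 -nrm_star_mul ps mul1r pp.
exact: nrm_chebyshev.
Qed.

Lemma nrm_cap g : sa_contraction g -> nrm (cap g) <= 2.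
Proof.
move=> gc; have := nrmD (g ** g) (half_bend g); rewrite -/(cap g).
have := nrm_half_root (nrm_bend_arg gc); rewrite -/(half_bend g).
have := nrm_sac_mul g gc; have := gc.2; lra.
Qed.

(** [1 - g^2 = (1 + g) (1 - g)] costs a factor 2, and [half_bend g ** b] is at most twice
    [g^2 (1 - g^2) b] in norm, a factor 4; together 6. *)
Lemma nrm_sub_trunc g b : sa_contraction g ->
  nrm (b - cap g ** b) <= 6 * nrm (b - g ** b) /\
  nrm (b - spike g ** b) <= 6 * nrm (b - g ** b).
Proof.
move=> gc; set c := b - g ** b.
have qb : nrm (b - (g ** g) ** b) <= 2 * nrm c.
  have -> : b - (g ** g) ** b = c + g ** c by rewrite /c cmulBr cmulA; zmod.
  by have := nrmD c (g ** c); have := nrm_sac_mul c gc; lra.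
have hb : nrm (half_bend g ** b) <= 4 * nrm c.
  rewrite (le_trans (nrm_half_root_mul _ (nrm_bend_arg gc)))//.
  have -> : bend_arg g ** b = g ** (g ** (b - (g ** g) ** b)).
    by rewrite /bend_arg cmulBl !cmulBr !cmulA.
  have := nrm_sac_mul (g ** (b - (g ** g) ** b)) gc.
  by have := nrm_sac_mul (b - (g ** g) ** b) gc; lra.
split.
- have -> : b - cap g ** b = b - (g ** g) ** b - half_bend g ** b.
    by rewrite /cap cmulDl; zmod.
  by have := nrmB (b - (g ** g) ** b) (half_bend g ** b); lra.
- have -> : b - spike g ** b = b - (g ** g) ** b + half_bend g ** b.
    by rewrite /spike cmulBl; zmod.
  by have := nrmD (b - (g ** g) ** b) (half_bend g ** b); lra.
Qed.

Lemma spike_fixed g b : sa_contraction g -> g ** b = b -> spike g ** b = b.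
Proof.
move=> gc gb; apply/esym/subr0_eq/nrm_eq0.
by have [_] := nrm_sub_trunc b gc; rewrite gb subrr nrm0 mulr0.
Qed.

Lemma fixed_cap f g : sa_contraction g -> f ** g = g -> f ** cap g = cap g.
Proof.
move=> gc fg; rewrite /cap cmulDr cmulA fg; congr (_ + _).
apply: half_root_fixed; first exact: nrm_bend_arg.
by rewrite /bend_arg cmulBr !cmulA fg.
Qed.

Lemma spike_continuous eps : 0 < eps -> exists2 del, 0 < del &
  forall g g', sa_contraction g -> sa_contraction g' -> nrm (g - g') < del ->
  nrm (spike g - spike g') < eps.
Proof.
move=> e0; have [|del d0 hdel] := @half_root_continuous R A (eps / 2); first lra.
(* Squaring is 2-Lipschitz on selfadjoint contractions, so [bend_arg] is 6-Lipschitz there. *)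
exists (Num.min (del / 6) (eps / 4)) => [|g g' gc gc'].
  by rewrite lt_min; apply/andP; split; lra.
rewrite lt_min => /andP[gd ge].
have qc : sa_contraction (g ** g).
  by split; [rewrite starM gc.1|exact: le_trans (nrm_sac_mul g gc) gc.2].
have qc' : sa_contraction (g' ** g').
  by split; [rewrite starM gc'.1|exact: le_trans (nrm_sac_mul g' gc') gc'.2].
have sqB a b : sa_contraction a -> sa_contraction b ->
    nrm (a ** a - b ** b) <= 2 * nrm (a - b).
  move=> ac bc; rewrite cmulBB (le_trans (nrmD _ _))//.
  have := nrm_sac_mul (a - b) ac; have := nrm_mul_sac (a - b) bc; lra.
have q2 := sqB _ _ gc gc'; have qq2 := sqB _ _ qc qc'.
have kd : nrm (bend_arg g - bend_arg g') < del.
  have -> : bend_arg g - bend_arg g' = (g ** g - g' ** g') -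
      ((g ** g) ** (g ** g) - (g' ** g') ** (g' ** g')).
    by rewrite /bend_arg; zmod.
  rewrite (le_lt_trans (nrmB _ _))//; lra.
have := hdel _ _ (nrm_bend_arg gc) (nrm_bend_arg gc') kd.
rewrite -/(half_bend g) -/(half_bend g') => hh.
have -> : spike g - spike g' =
  (g ** g - g' ** g') - (half_bend g - half_bend g') by rewrite /spike; zmod.
rewrite (le_lt_trans (nrmB _ _))//; lra.
Qed.

Lemma star_fixed f b : star f = f -> star b = b -> f ** b = b -> b ** f = b.
Proof. by move=> fs bs /(congr1 star); rewrite starM fs bs. Qed.

End Truncation.

(** * Extending increasing sequences *)

Lemma dependent_choice_nat (T : Type) (Q : nat -> T -> Prop)
    (S : nat -> T -> T -> Prop) :
  (exists t, Q 0 t) ->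
  (forall n t, Q n t -> exists t', Q n.+1 t' /\ S n t t') ->
  exists s : nat -> T, forall n, Q n (s n) /\ S n (s n) (s n.+1).
Proof.
move=> /cid[t0 Qt0] step.
have /choice[f fP] (nt : nat * T) : exists t',
    Q nt.1 nt.2 -> Q nt.1.+1 t' /\ S nt.1 nt.2 t'.
  have [/step[t' ht']|nQ] := pselect (Q nt.1 nt.2); first by exists t'.
  by exists nt.2.
pose s := fix s n := if n is n'.+1 then f (n', s n') else t0.
have Qs n : Q n (s n) by elim: n => //= n /(fP (n, _)) [].
by exists s => n; split=> //; have [] := fP (n, s n) (Qs n).
Qed.

Section Extension.
Context {R : realType} {A : cstarAlgType R}.
Implicit Types (a b c e f g t : A) (eps : R) (d x : nat -> A).

Context (units : forall b c eps, 0 < eps -> exists x : A,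
  [/\ sa_contraction x, nrm (b - x ** b) < eps & nrm (c - x ** c) < eps]).

(* [cut_poly] of [1 - (1 - d'^2) (1 - x^2) (1 - d'^2)] for [x] far out in an
   approximate unit: the outer factors make it a unit for [d] exactly. *)
Lemma almost_unit_above (d d' : A) b c eps :
  sa_contraction d' -> d' ** d = d -> 0 < eps ->
  exists e, [/\ sa_contraction e, e ** d = d,
    nrm (b - e ** b) < eps & nrm (c - e ** c) < eps].
Proof.
move=> dc dd e0; pose D a := a - d' ** (d' ** a).
(* [cut_polyB] costs a factor 9, and [1 - x^2 = (1 + x) (1 - x)] a factor 2. *)
have [|x [xc xb xc']] := units (D b) (D c) (eps := eps / 18); first lra.
pose Y a := a - x ** (x ** a).
pose p := d' ** d'; pose y := x ** x.
pose e := p + p - p ** p + y - p ** y - y ** p + p ** (y ** p).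
have eE a : a - e ** a = D (Y (D a)).
  rewrite /e /p /y /D /Y !(cmulDl, cmulDr, cmulNl, cmulNr) -!cmulA; zmod.
have ps : star p = p by rewrite starM dc.1.
have ys : star y = y by rewrite starM xc.1.
have es : star e = e.
  rewrite /e; move: (p) (y) ps ys => q z qs zs.
  by rewrite !(starD, starN, starM) qs zs !cmulA; zmod.
have nrmYD a : nrm (a - e ** a) <= nrm (Y (D a)).
  by rewrite eE nrm_sub_sqr.
have e2 : nrm e <= 2.
  apply: nrm_le_op => // a; rewrite -(subKr a (e ** a)).
  have := nrmB a (a - e ** a); have := nrmYD a.
  have : nrm (Y (D a)) <= nrm (D a) by exact: nrm_sub_sqr.
  have : nrm (D a) <= nrm a by exact: nrm_sub_sqr.
  lra.
have small a : nrm (D a - x ** D a) < eps / 18 ->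
    nrm (a - cut_poly e ** a) < eps.
  move=> xa; have := cut_polyB a e2; have := nrmYD a.
  have -> : Y (D a) = (D a - x ** D a) + x ** (D a - x ** D a).
    by rewrite /Y cmulBr; zmod.
  have := nrmD (D a - x ** D a) (x ** (D a - x ** D a)).
  have := nrm_sac_mul (D a - x ** D a) xc; lra.
exists (cut_poly e); split; [exact: cut_poly_sac| |exact: small|exact: small].
apply/esym/subr0_eq/nrm_eq0; rewrite (le_trans (cut_polyB _ e2))//.
by rewrite eE /D !dd subrr /Y !cmul0r subrr !cmul0r subrr nrm0 mulr0.
Qed.

Definition compress a g := (spike g ** a) ** spike g.

Lemma compress_sac a g :
  sa_contraction a -> sa_contraction g -> sa_contraction (compress a g).
Proof.
move=> ac gc; have pc := spike_sac gc; split.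
  by rewrite !starM ac.1 pc.1 cmulA.
rewrite (le_trans (nrm_mul_sac _ pc))// (le_trans (nrm_sac_mul _ pc))//.
exact: ac.2.
Qed.

(** [p a p - a = (p a - a) p + (p a - a)^*], and each term has norm at most [6 |a - g a|]. *)
Lemma nrm_compressB a g : sa_contraction a -> sa_contraction g ->
  nrm (compress a g - a) <= 12 * nrm (a - g ** a).
Proof.
move=> ac gc; have pc := spike_sac gc.
rewrite /compress; set p := spike g in pc *.
have -> : (p ** a) ** p - a = (p ** a - a) ** p + star (p ** a - a).
  by rewrite starB starM ac.1 pc.1 cmulBl; zmod.
rewrite (le_trans (nrmD _ _))// nrm_star (nrmBC (p ** a)).
have [_] := nrm_sub_trunc a gc; rewrite -/p.
by have := nrm_mul_sac (p ** a - a) pc; rewrite (nrmBC (p ** a)); lra.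
Qed.

(** [del] is uniform in [a], so tolerances can be fixed before the sequence is built; [del <= eps]
    makes iterated moduli decrease. *)
Lemma compress_continuous eps : 0 < eps -> exists2 del, 0 < del <= eps &
  forall a g g', sa_contraction a -> sa_contraction g -> sa_contraction g' ->
  nrm (g - g') < del -> nrm (compress a g - compress a g') < eps.
Proof.
move=> e0; have [|del d0 hdel] := @spike_continuous R A (eps / 2); first lra.
exists (Num.min del eps) => [|a g g' ac gc gc'].
  by rewrite lt_min d0 e0 ge_min lexx orbT.
rewrite lt_min => /andP[gd _]; have := hdel _ _ gc gc' gd.
have pc := spike_sac gc; have pc' := spike_sac gc'.
rewrite /compress cmulBB -cmulBl; set u := spike g - spike g' => ue.
have h1 : nrm ((spike g ** a) ** u) <= nrm u.
  rewrite -cmulA (le_trans (nrm_sac_mul _ pc))//; exact: nrm_sac_mul.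
have h2 : nrm ((u ** a) ** spike g') <= nrm u.
  rewrite (le_trans (nrm_mul_sac _ pc'))//; exact: nrm_mul_sac.
by rewrite (le_lt_trans (nrmD _ _))//; lra.
Qed.

Fixpoint nest x (i n : nat) t : A :=
  if n is n'.+1 then compress (x i) (nest x i.+1 n' t) else t.

(** Unrolled at the innermost level, successive approximants of one [g_i] differ only in their
    innermost argument. *)
Lemma nestSr x i n t : nest x i n.+1 t = nest x i n (compress (x (i + n)%N) t).
Proof.
elim: n i => [|n IH] i; first by rewrite addn0.
by rewrite -[LHS]/(compress _ (nest x i.+1 n.+1 t)) IH addSnnS.
Qed.

Lemma nest_sac x i n t : (forall j, sa_contraction (x j)) ->
  sa_contraction t -> sa_contraction (nest x i n t).
Proof. by move=> xc tc; elim: n i => //= n IH i; exact: compress_sac. Qed.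

Lemma sac_limit g : (forall eps, 0 < eps ->
  exists2 a, sa_contraction a & nrm (g - a) <= eps) -> sa_contraction g.
Proof.
move=> h; split; last first.
  apply/ler_addgt0Pr => eps e0; have [a [_ a1] ga] := h _ e0.
  by rewrite -(subrK a g) (le_trans (nrmD _ _))//; lra.
apply/subr0_eq/(nrm_small (C := 2)) => eps e0; have [a [ac _] ga] := h _ e0.
have -> : star g - g = star (g - a) - (g - a) by rewrite starB ac; zmod.
by rewrite (le_trans (nrmB _ _))// nrm_star; lra.
Qed.

Lemma pow_half_small eps : 0 < eps -> exists n, 2^-1 ^+ n < eps.
Proof.
move=> e0; exists (Num.truncn eps^-1).+1.
rewrite -[ltRHS]invrK exprVn ltf_pV2 ?posrE ?invr_gt0 ?exprn_gt0//.
rewrite (lt_le_trans (truncnS_gt _))// -natrX ler_nat.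
exact: ltnW (ltn_expl _ _).
Qed.

Lemma cut_poly_fixed f b : nrm f <= 2 -> f ** b = b -> cut_poly f ** b = b.
Proof.
move=> f2 fb; apply/esym/subr0_eq/nrm_eq0.
by rewrite (le_trans (cut_polyB _ f2))// fb subrr nrm0 mulr0.
Qed.

Lemma fixed_cut_poly f g : f ** g = g -> f ** cut_poly g = cut_poly g.
Proof.
move=> fg; rewrite /cut_poly cmulZr cmulBr cmulA fg.
by rewrite !mulrS mulr0n !cmulDr fg cmul0r.
Qed.

Lemma increasing_extension d c :
  (forall n, sa_contraction (d n)) -> (forall n, d n.+1 ** d n = d n) ->
  exists e : nat -> A, [/\ forall n, sa_contraction (e n),
    forall n, e n ** d n = d n, forall n, e n.+1 ** e n = e n &
    forall eps, 0 < eps -> exists n, nrm (c - e n ** c) < eps].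
Proof.
move=> dc dd.
have /choice[m mP] eps : exists del, 0 < eps -> 0 < del <= eps /\
    forall a g g', sa_contraction a -> sa_contraction g -> sa_contraction g' ->
    nrm (g - g') < del -> nrm (compress a g - compress a g') < eps.
  have [/compress_continuous[del h1 h2]|ne] := pselect (0 < eps).
    by exists del.
  by exists 0.
have iter_m_gt0 n eps : 0 < eps -> 0 < iter n m eps.
  by move=> e0; elim: n => //= n /mP[/andP[]].
have iter_m_le i n eps : 0 < eps -> iter (i + n) m eps <= iter n m eps.
  move=> e0; elim: i => //= i IH.
  have [/andP[_ mle] _] := mP _ (iter_m_gt0 (i + n)%N _ e0).
  exact: le_trans mle IH.
have half_gt0 n : 0 < 2^-1 ^+ n :> R by rewrite exprn_gt0 ?invr_gt0.
(* The [k]-th tolerance [iter k m _] does not depend on the sequence under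
   construction, only on the number of nested compressions. *)
have [|k a [ac ad _]|x xP] := @dependent_choice_nat A
  (fun k a => [/\ sa_contraction a, a ** d k = d k &
                  nrm (c - a ** c) < 2^-1 ^+ k])
  (fun k a b => nrm (compress a b - a) < iter k m (2^-1 ^+ k.+1)).
- have [e [ec ed e1 _]] := almost_unit_above c c (dc 1%N) (dd 0) (half_gt0 0).
  by exists e.
- have tol_gt0 := iter_m_gt0 k _ (half_gt0 k.+1).
  (* The first bound is for [c]; the second keeps [compress a e] near [a], with 12 from
     [nrm_compressB]. *)
  have eps0 : 0 < Num.min (2^-1 ^+ k.+1) (iter k m (2^-1 ^+ k.+1) / 12).
    by rewrite lt_min half_gt0 divr_gt0.
  have [e [ec ed]] := almost_unit_above c a (dc k.+2) (dd k.+1) eps0.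
  rewrite !lt_min => /andP[ce _] /andP[_ ae]; exists e; split=> //.
  by rewrite (le_lt_trans (nrm_compressB ac ec))//; lra.
have xc k : sa_contraction (x k) by have [[]] := xP k.
have xd k : x k ** d k = d k by have [[]] := xP k.
pose v i n := nest x i n (x (i + n)%N).
have vc i n : sa_contraction (v i n) by exact: nest_sac.
have vS i n : v i n.+1 = compress (x i) (v i.+1 n) by rewrite /v /= addSnnS.
have nest_cont i n t t' eps : 0 < eps ->
    sa_contraction t -> sa_contraction t' ->
    nrm (t - t') < iter n m eps -> nrm (nest x i n t - nest x i n t') < eps.
  move=> e0 tc tc'; elim: n i eps e0 => //= n IH i eps e0 tt'.
  have [/andP[m0 _] h] := mP _ e0.
  apply: h; [exact: xc|exact: nest_sac|exact: nest_sac|].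
  by apply: IH; rewrite // -iterSr.
have vd i n : v i n ** d i = d i.
  elim: n i => [|n IH] i; first by rewrite /v /= addn0.
  have := IH i.+1; rewrite vS; have wc := vc i.+1 n.
  set w := v i.+1 n in wc * => wd.
  have wdi : w ** d i = d i by rewrite -(dd i) cmulA wd.
  by rewrite /compress -!cmulA (spike_fixed wc wdi) xd spike_fixed.
have /choice[g gP] i : exists l, forall n, nrm (l - v i n) <= 2^-1 ^+ (i + n).
  apply: telescoping_limit => [n|eps e0|n]; first exact: ltW.
  - have [n ne] := pow_half_small e0; exists n; apply: le_lt_trans ne.
    by rewrite ler_wiXn2l ?leq_addl// ?invr_ge0// invf_le1// ler1n.
  - have -> : 2^-1 ^+ (i + n) - 2^-1 ^+ (i + n.+1) = 2^-1 ^+ (i + n).+1 :> R.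
      by rewrite addnS exprS; field.
    rewrite /v nestSr -addnS ltW//; apply: nest_cont => //.
      by apply: compress_sac.
    (* The choice of [x] allows for [i + n] iterated moduli; only [n] are used here, and dropping
       the others can only enlarge the tolerance. *)
    have [_] := xP (i + n)%N; rewrite addnS => /lt_le_trans; apply.
    exact: iter_m_le.
have gv i eps : 0 < eps -> exists n, nrm (g i - v i n) < eps.
  move=> e0; have [n ne] := pow_half_small e0; exists n.
  rewrite (le_lt_trans (gP i n))// (le_lt_trans _ ne)//.
  by rewrite ler_wiXn2l ?leq_addl// ?invr_ge0// invf_le1// ler1n.
have gc i : sa_contraction (g i).
  by apply: sac_limit => eps /(gv i)[n /ltW h]; exists (v i n).
have gd i : g i ** d i = d i.
  apply/subr0_eq/(nrm_small (C := 1)) => eps /(gv i)[n h].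
  rewrite -{2}(vd i n) -cmulBl mul1r (le_trans (nrm_mul_sac _ (dc i)))//.
  exact: ltW.
(* This is [vS] in the limit, by continuity of [compress]. *)
have gE i : g i = compress (x i) (g i.+1).
  apply/subr0_eq/(nrm_small (C := 2)) => eps e0.
  have [/andP[m0 _] h] := mP _ e0.
  have [|n ne] := @pow_half_small (Num.min (m eps) eps).
    by rewrite lt_min m0.
  have small j : 2^-1 ^+ (j + n) < Num.min (m eps) eps.
    apply: le_lt_trans ne.
    by rewrite ler_wiXn2l ?leq_addl// ?invr_ge0// invf_le1// ler1n.
  have := small i.+1; rewrite lt_min => /andP[sm _].
  have := small i.+1; rewrite lt_min => /andP[_ se].
  have /ltW := h _ _ _ (xc i) (vc i.+1 n) (gc i.+1)
    (le_lt_trans (eq_ind_r (fun r => r <= _) (gP i.+1 n) (nrmBC _ _)) sm).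
  have := gP i n.+1; rewrite vS addnS -addSn => h1 h2.
  have -> : g i - compress (x i) (g i.+1) =
      g i - compress (x i) (v i.+1 n) +
      (compress (x i) (v i.+1 n) - compress (x i) (g i.+1)) by zmod.
  by rewrite (le_trans (nrmD _ _))//; lra.
have capc i : nrm (cap (g i)) <= 2 by exact: nrm_cap.
exists (fun i => cut_poly (cap (g i))); split=> [i|i|i|eps e0].
- exact: cut_poly_sac (star_cap (gc i)) (capc i).
- apply: cut_poly_fixed => //; apply/esym/subr0_eq/nrm_eq0.
  have [+ _] := nrm_sub_trunc (d i) (gc i).
  by rewrite gd subrr nrm0 mulr0.
- apply/fixed_cut_poly/cut_poly_fixed => //; apply: fixed_cap => //.
  by rewrite (gE i) /compress !cmulA cap_spike.
(* [54 = 9 * 6] from [cut_polyB] and [nrm_sub_trunc]; replacing [x n] by [g n] adds at most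
   [2^-n * nrm c] to an error below [2^-n]. *)
- have c0 := nrm_ge0 c; pose C := 54 * (1 + nrm c) + 1.
  have C0 : 0 < C by rewrite /C; lra.
  have [n] := pow_half_small (divr_gt0 e0 C0).
  rewrite ltr_pdivlMr// => ne; exists n.
  have [_ _ cx] := (xP n).1.
  have gx : nrm (g n - x n) <= 2^-1 ^+ n.
    by have := gP n 0; rewrite /v /= addn0.
  have := cut_polyB c (capc n); have [+ _] := nrm_sub_trunc c (gc n).
  have -> : c - g n ** c = c - x n ** c - (g n - x n) ** c.
    by rewrite cmulBl; zmod.
  have := nrmB (c - x n ** c) ((g n - x n) ** c).
  have := nrmM (g n - x n) c; have := half_gt0 n.
  have : nrm (g n - x n) * nrm c <= 2^-1 ^+ n * nrm c by rewrite ler_wpM2r.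
  by move: ne cx; rewrite /C; move: (2^-1 ^+ n) => r; lra.
Qed.

End Extension.

(** * Recursion over the first uncountable cardinal *)

Lemma well_founded_trichotomy (T : Type) : exists lt : T -> T -> Prop,
  well_founded lt /\ forall x y, [\/ lt x y, x = y | lt y x].
Proof.
have [le lewo] := well_ordering_principle {classic T}.
have min_ex (P : set T) :
    P !=set0 -> exists2 z, P z & forall x, P x -> le z x.
  move=> [x Px]; have [|z [[zP zmin] _]] := lewo (fun x => `[< P x >]).
    by exists x; apply/asboolP.
  by exists z; [exact/asboolP | move=> y Py; apply: zmin; apply/asboolP].
have lexx x : le x x.
  by have [|z -> zle] := min_ex [set x]; [exists x | exact: zle].
have le_anti x y : le x y -> le y x -> x = y.
  move=> xy yx; have [|z [_ zuniq]] := lewo (fun z => `[< z = x \/ z = y >]).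
    by exists x; apply/asboolP; left.
  rewrite -(zuniq x) 1?(zuniq y)//; split; do ?[by apply/asboolP; tauto].
  - by move=> w /asboolP[] ->.
  - by move=> w /asboolP[] ->.
exists (fun x y => le x y /\ x <> y); split=> [x|x y].
  apply: contrapT => nx.
  have [|z nz zmin] := min_ex [set y | ~ Acc (fun x y => le x y /\ x <> y) y].
    by exists x.
  apply: nz; constructor => y [yz yNz]; apply: contrapT => ny.
  by apply: yNz; apply: le_anti yz _; exact: zmin.
have [->|xNy] := pselect (x = y); first by apply: Or32.
have [|z [] -> zle] := min_ex [set x; y]; first by exists x; left.
- by apply: Or31; split=> //; apply: zle; right.
- by apply: Or33; split; [apply: zle; left|exact/nesym].
Qed.

(** If a well-order of [W] has an uncountable initial segment, take the least [x] bounding one.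
    Minimality of [W] embeds it below [x], where initial segments are countable; pull the order
    back. *)
Lemma first_uncountable_order (W : Type) : first_uncountable W ->
  exists lt : W -> W -> Prop, [/\ well_founded lt,
    forall x y, [\/ lt x y, x = y | lt y x] &
    forall x, countable [set y | lt y x]].
Proof.
move=> [Wunc Wmin]; have [lt [lt_wf lt_tri]] := well_founded_trichotomy W.
have [ltc|/existsNP[x0 nx0]] := pselect (forall x, countable [set y | lt y x]).
  by exists lt.
have [x [nx xmin]] : exists x, ~ countable [set y | lt y x] /\
    forall y, lt y x -> countable [set z | lt z y].
  elim/(well_founded_ind lt_wf): x0 nx0 => x IH nx.
  have [h|/existsNP[y /not_implyP[yx ny]]] :=
      pselect (forall y, lt y x -> countable [set z | lt z y]).
    by exists x.
  exact: IH yx ny.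
have [W0|] := pfcard_geP (Wmin _ _ nx).
  by case: Wunc; rewrite W0; exact: countable0.
move=> /surjfunPex[g gE].
have /choice[f fP] w : exists v, lt v x /\ g v = w.
  by have : [set: W] w by []; rewrite gE => -[v vx <-]; exists v.
have f_inj v w : f v = f w -> v = w.
  by move=> fvw; rewrite -(fP v).2 fvw (fP w).2.
exists (fun v w => lt (f v) (f w)); split=> [|v w|w].
- exact: Inverse_Image.wf_inverse_image lt_wf.
- by have [?|/f_inj|?] := lt_tri (f v) (f w);
    [apply: Or31|apply: Or32|apply: Or33].
- have /countable_injP[j j_inj] := xmin _ (fP w).1.
  apply/countable_injP; exists (j \o f) => y z.
  by rewrite !inE => yw zw jyz; apply/f_inj/j_inj; rewrite ?inE.
Qed.

Section Recursion.
Context {R : realType} {A : cstarAlgType R}.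
Implicit Types (a b c e : A) (D : set A) (eps : R).

Context (units : forall b c eps, 0 < eps -> exists x : A,
  [/\ sa_contraction x, nrm (b - x ** b) < eps & nrm (c - x ** c) < eps]).

(* On selfadjoint elements [a << b] reads [b ** a = a]. *)
Definition ll_directed D := (forall a, D a -> sa_contraction a) /\
  forall a b, D a -> D b -> exists c, [/\ D c, c ** a = a & c ** b = b].

Lemma sac0 : sa_contraction (0 : A).
Proof. by split; rewrite ?star0 ?nrm0. Qed.

(** An increasing sequence [d] that absorbs an enumeration of [D] is extended to [e]. Each old or
    new element is fixed by all late [e k], which gives directedness. *)
Lemma directed_extension D c : countable D -> ll_directed D ->
  exists D', [/\ countable D', ll_directed D', D `<=` D' &
    forall eps, 0 < eps -> exists2 e, D' e & nrm (c - e ** c) < eps].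
Proof.
(* Adding [0], which is [<<]-below everything, makes the set nonempty, hence the range of a
   sequence. *)
move=> Dcount [Dc Ddir]; pose D0 := [set 0] `|` D.
have D0c a : D0 a -> sa_contraction a by move=> [->|/Dc//]; exact: sac0.
have D0dir a b : D0 a -> D0 b -> exists c, [/\ D0 c, c ** a = a & c ** b = b].
  have dir0 a' : D a' -> exists c, [/\ D0 c, c ** 0 = 0 & c ** a' = a'].
    by move=> Da; have [c' [Dc' h _]] := Ddir _ _ Da Da; exists c'; split;
      rewrite ?cmul0r//; right.
  move=> [->|Da] [->|Db].
  - by exists 0; split; rewrite ?cmul0r//; left.
  - exact: dir0.
  - by have [c' [? ? ?]] := dir0 _ Da; exists c'.
  - by have [c' [? ? ?]] := Ddir _ _ Da Db; exists c'; split=> //; right.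
have [s sE] : exists s : nat -> A, D0 = range s.
  have : (D0 #<= [set: nat])%card.
    have -> : D0 = \bigcup_(b in [set: bool]) (if b then [set 0] else D).
      by apply/seteqP; split=> [a [?|?]|a [[] _ ?]];
        [exists true|exists false|left|right].
    by apply: bigcup_countable => // -[] _; [exact: countable1|].
  move=> /pfcard_geP[D00|/surjfunPex//].
  by have : D0 0 by [left]; rewrite D00.
have D0s n : D0 (s n) by rewrite sE; exists n.
have [|n a Da|d dP] := @dependent_choice_nat A (fun _ a => D0 a)
    (fun n a b => b ** a = a /\ b ** s n = s n).
- by exists 0; left.
- by have [b [Db ba bs]] := D0dir _ _ Da (D0s n); exists b.
have [|n|e [ec ed ee e_c]] := @increasing_extension _ _ units d c.
- by move=> n; exact/D0c/(dP n).1.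
- exact: (dP n).2.1.
pose D' := D0 `|` range e.
have eD n : D' (e n) by right; exists n.
have eventually_e n a : e n ** a = a -> forall k, e (n + k)%N ** a = a.
  by move=> ea; elim=> [|k IH]; rewrite ?addn0// addnS -IH cmulA ee.
have absorb a : D' a -> exists n, forall k, e (n + k)%N ** a = a.
  move=> [|[n _ <-]]; last by exists n.+1; apply: eventually_e.
  rewrite sE => -[n _ <-]; exists n.+1; apply: eventually_e.
  by rewrite -(dP n).2.2 cmulA ed.
exists D'; split=> [||a Da|eps e0].
- have -> : D' = \bigcup_(b in [set: bool]) (if b then D0 else range e).
    by apply/seteqP; split=> [a [?|?]|a [[] _ ?]];
      [exists true|exists false|left|right].
  apply: bigcup_countable => // -[] _; last exact: card_image_le.
  by rewrite sE; exact: card_image_le.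
- split=> [a [/D0c//|[n _ <-]//]|a b /absorb[n na] /absorb[m mb]].
  by exists (e (n + m)%N); split=> //; rewrite addnC.
- by left; right.
- by have [n h] := e_c _ e0; exists (e n).
Qed.

Lemma directed_exhaustion (W : Type) (u : W -> A) : first_uncountable W ->
  exists D, ll_directed D /\ forall w eps, 0 < eps ->
    exists2 e, D e & nrm (u w - e ** u w) < eps.
Proof.
move=> /first_uncountable_order[lt [lt_wf lt_tri lt_count]].
(* Made total by a default value, [ext] lets the recursion run first; the invariant [DP] then
   follows by induction. *)
have /choice[ext extP] (Dc : set A * A) : exists D',
    countable Dc.1 -> ll_directed Dc.1 ->
    [/\ countable D', ll_directed D', Dc.1 `<=` D' &
      forall eps, 0 < eps -> exists2 e, D' e & nrm (Dc.2 - e ** Dc.2) < eps].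
  have [[h1 h2]|nh] := pselect (countable Dc.1 /\ ll_directed Dc.1); last first.
    by exists set0 => h1 h2; case: nh.
  by have [D' D'P] := directed_extension Dc.2 h1 h2; exists D'.
pose F x (rec : forall y, lt y x -> set A) :=
  ext ([set a | exists y (yx : lt y x), rec y yx a], u x).
pose D := Fix lt_wf (fun=> set A) F.
pose U x := [set a | exists2 y, lt y x & D y a].
have DE x : D x = ext (U x, u x).
  rewrite /D Fix_eq => [|{}x f g fg].
    congr (ext (_, _)); apply/seteqP.
    by split=> [a [y [yx ya]]|a [y yx ya]]; exists y => //; exists yx.
  congr F; apply: functional_extensionality_dep => y.
  exact: functional_extensionality_dep.
have DP x : [/\ countable (D x), ll_directed (D x), U x `<=` D x &
    forall eps, 0 < eps -> exists2 e, D x e & nrm (u x - e ** u x) < eps].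
  elim/(well_founded_ind lt_wf): x => x IH.
  rewrite DE; apply: (extP (U x, u x)) => /=.
    have -> : U x = \bigcup_(y in [set y | lt y x]) D y.
      by apply/seteqP; split=> a [y ? ?]; exists y.
    by apply: bigcup_countable => // y /IH[].
  split=> [a [y /IH[_ [yc _] _ _] /yc//]|a b [y yx ya] [z zx zb]].
  have join w a' b' : lt w x -> D w a' -> D w b' ->
      exists c, [/\ U x c, c ** a' = a' & c ** b' = b'].
    move=> wx wa wb; have [_ [_ wdir] _ _] := IH _ wx.
    by have [c [? ? ?]] := wdir _ _ wa wb; exists c; split=> //; exists w.
  have [yz|yz|zy] := lt_tri y z.
  - by apply: (join z) => //; have [_ _ + _] := IH _ zx; apply; exists y.
  - by apply: (join z) => //; rewrite -yz.
  - by apply: (join y) => //; have [_ _ + _] := IH _ yx; apply; exists z.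
exists [set a | exists x, D x a]; split; last first.
  move=> w eps e0; have [_ _ _ /(_ _ e0)[e De h]] := DP w.
  by exists e => //; exists w.
split=> [a [x xa]|a b [x xa] [y yb]].
  by have [_ [+ _] _ _] := DP x; apply.
have join w : D w a -> D w b -> exists c,
    [/\ exists x, D x c, c ** a = a & c ** b = b].
  move=> wa wb; have [_ [_ wdir] _ _] := DP w.
  by have [c [? ? ?]] := wdir _ _ wa wb; exists c; split=> //; exists w.
have [xy|xy|yx] := lt_tri x y.
- by apply: (join y) => //; have [_ _ + _] := DP y; apply; exists x.
- by apply: (join y) => //; rewrite -xy.
- by apply: (join x) => //; have [_ _ + _] := DP x; apply; exists y.
Qed.

End Recursion.

(** * Approximate units *)

Section ApproximateUnits.
Context {R : realType} {A : cstarAlgType R}.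
Implicit Types (a b c e : A) (eps : R).

Lemma nrm_le1 a : `|a| <= 1 <-> nrm a <= 1.
Proof.
by rewrite normE -[1 in X in X <-> _](rmorph1 (@real_complex R)) lecR.
Qed.

(** The definition multiplies on the right, the estimates here on the left; taking adjoints passes
    from [c] to [star c]. *)
Lemma approximate_unit_left (L : Type) (prec : L -> L -> Prop) (u : L -> A) :
  approximate_unit prec u -> (forall l, sa_contraction (u l)) /\
  forall c eps, 0 < eps ->
    exists l0, forall l, prec l0 l -> nrm (c - u l ** c) < eps.
Proof.
move=> [_ u_pos u_lim]; have uc l : sa_contraction (u l).
  have [[b ub] /nrm_le1 u1] := u_pos l; split=> //.
  by rewrite ub starM starK.
split=> // c eps e0.
have nbhs_eps : nbhs (0 : R[i]^o) [set z : R[i]^o | `|z| < eps%:C].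
  apply/nbhs_ballP; exists eps%:C; rewrite /= ?ltcR// => z.
  by rewrite -ball_normE /= sub0r normrN.
have [l0 _ l0P] := u_lim (star c) _ nbhs_eps.
exists l0 => l /l0P; rewrite /= normr_id normE ltcR.
by rewrite -nrm_star starB starM starK (uc l).1.
Qed.

Lemma approximate_unit_units (L : Type) (prec : L -> L -> Prop) (u : L -> A) :
  approximate_unit prec u -> forall b c eps, 0 < eps -> exists x : A,
  [/\ sa_contraction x, nrm (b - x ** b) < eps & nrm (c - x ** c) < eps].
Proof.
move=> uu b c eps e0; have [[_ join] _ _] := uu.
have [uc u_left] := approximate_unit_left uu.
have [l lP] := u_left b _ e0; have [m mP] := u_left c _ e0.
have [n [ln mn]] := join l m.
by exists (u n); split; [exact: uc|exact: lP|exact: mP].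
Qed.

(* Squaring turns selfadjoint contractions into positive ones and preserves
   [<<], so positivity plays no role before this point. *)
Lemma ll_unital_directed (D : set A) : ll_directed D ->
  (forall b eps, 0 < eps -> exists2 e, D e & nrm (b - e ** b) < eps) ->
  ll_unital A.
Proof.
move=> [Dc Ddir] D_unit.
pose prec (x y : {a | D a}) := sval y ** sval x = sval x.
have Lc (x : {a | D a}) : sa_contraction (sval x) by apply/Dc/svalP.
exists {a | D a}, prec, (fun x => sval x ** sval x); split; last first.
  move=> x y xy; have := star_fixed (Lc y).1 (Lc x).1 xy => yx.
  by rewrite /ll cmulA -(cmulA (sval x)) yx -(cmulA (sval x)) yx.
split.
- split=> [x y z xy yz|[a Da] [b Db]]; first by rewrite /prec -xy cmulA yz.
  by have [c [Dc' ca cb]] := Ddir _ _ Da Db; exists (exist _ c Dc').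
- move=> x; have [xs x1] := Lc x; split; first by exists (sval x); rewrite xs.
  by apply/nrm_le1; apply: le_trans x1; exact/nrm_sac_mul/Lc.
move=> a P /nbhs_ballP[eps /= eps0 epsP].
have e0 : 0 < complex.Re eps by rewrite -ltcR RRe_real ?gtr0_real.
have [|e De ae] := D_unit (star a) (complex.Re eps / 8); first lra.
exists (exist _ e De) => // x /= ex; apply: epsP.
rewrite -ball_normE /= sub0r normrN normr_id normE -(RRe_real (gtr0_real eps0)).
rewrite ltcR -nrm_star; set y := sval x in ex *.
have yc : sa_contraction y := Lc x.
set c := star a in ae *; set f := c - e ** c in ae.
(* As [y e = e], [(1 - y^2) c = (1 - y^2) (c - e c)], and [1 - y^2 = (1 + y) (1 - y)] costs at most
   a factor 4. *)
have -> : star (a - a ** (y ** y)) = (f - y ** f) + y ** (f - y ** f).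
  rewrite starB !starM yc.1 -/c /f !(cmulBl, cmulBr) !cmulA.
  by rewrite -(cmulA y y e) !ex; zmod.
have := nrmD (f - y ** f) (y ** (f - y ** f)); have := nrmB f (y ** f).
have := nrm_sac_mul f yc; have := nrm_sac_mul (f - y ** f) yc; lra.
Qed.

End ApproximateUnits.

Theorem theorem1p3 (R : realType) (omega1 : Type)
    (homega1 : first_uncountable omega1) (A : cstarAlgType R) :
  cardinal_unital omega1 A -> ll_unital A.
Proof.
move=> [L [prec [u [uu u_card]]]]; have units := approximate_unit_units uu.
have [v uv] : exists v : omega1 -> A, range u `<=` range v.
  have [->|/surjfunPex[v ->]] := pfcard_geP u_card; last by exists v.
  by exists (fun=> 0).
have [D [D_dir D_u]] := directed_exhaustion units v homega1.
apply: (ll_unital_directed D_dir) => b eps e0.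
have [uc u_left] := approximate_unit_left uu.
have [l lP] := u_left b _ (divr_gt0 e0 (ltr0n _ 4)).
(* [prec] need not be reflexive, so an index strictly beyond [l] is taken. *)
have [[_ join] _ _] := uu; have [m [lm _]] := join l l.
have [|w _ wE] := uv (u m); first by exists m.
have [|e De we] := D_u w (eps / 4 / (1 + nrm b)).
  by rewrite !divr_gt0// ltr_wpDr ?nrm_ge0.
exists e => //; have ec := D_dir.1 _ De; rewrite wE in we.
(* [e] almost absorbs [u m], which almost absorbs [b]; each of the three terms is at most
   [eps / 4]. *)
have -> : b - e ** b =
    (b - u m ** b) + (u m - e ** u m) ** b - e ** (b - u m ** b).
  by rewrite !(cmulBl, cmulBr) cmulA; zmod.
have := nrmB (b - u m ** b + (u m - e ** u m) ** b) (e ** (b - u m ** b)).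
have := nrmD (b - u m ** b) ((u m - e ** u m) ** b).
have := nrm_sac_mul (b - u m ** b) ec; have := lP _ lm.
have := nrmM (u m - e ** u m) b; have b0 := nrm_ge0 b.
move: we; rewrite ltr_pdivlMr; last by lra.
have := nrm_ge0 (u m - e ** u m); lra.
Qed.
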